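(* Let $H$ be a finite-dimensional Hopf algebra over a field $k$ and let $D(H)$ be its Drinfeld double. Every $G$-projective $D(H)$-module is projective as an $H^*$-module (by restriction along the canonical algebra embedding $H^*\to D(H)$).
   Context: Sweedler notation $\Delta(h)=h_{(1)}\otimes h_{(2)}$ is used; $S$ is the antipode and $\varepsilon$ the counit of $H$; $H\mathrm{-mod}$ is the category of finite-dimensional left $H$-modules; $f(a?b)$ denotes $x\mapsto f(axb)$. $H^*$ is an algebra with product $(f*g)(h)=f(h_{(2)})g(h_{(1)})$ and unit $\varepsilon$. **Drinfeld double.** $D(H)=H^*\otimes_kH$ with the algebra structure in which $H^*$ (with product $*$) and $H$ are subalgebras, $\psi\cdot h=\psi\otimes h$ and $h\cdot\psi=\psi(S(h_{(1)})?h_{(3)})\otimes h_{(2)}$. **The comonad $G$.** The central monad $Z$ on $H\mathrm{-mod}$ is $Z(V)=H^*\otimes_kV$ with $h.(f\otimes v)=f(S(h_{(1)})?h_{(3)})\otimes h_{(2)}.v$, multiplication $\mu_V(f\otimes g\otimes v)=(f*g)\otimes v$, unit $\eta_V(v)=\varepsilon\otimes v$. The category $Z\mathrm{-mod}$ of $Z$-modules $(V,\beta\colon Z(V)\to V)$ is identified with $D(H)\mathrm{-mod}$ (finite-dimensional modules) via $(\psi\otimes h).v=\beta(\psi\otimes h.v)$. $G$ is the comonad $G(V,\beta)=(Z(V),\mu_V)$ on $Z\mathrm{-mod}\cong D(H)\mathrm{-mod}$, with counit $\varepsilon_{(V,\beta)}=\beta$ and comultiplication $Z(\eta_V)$. **$G$-projectivity.**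 An object $X$ is $G$-projective if there is a morphism $s\colon X\to G(X)$ with $\varepsilon_X\circ s=\mathrm{id}_X$. *)

(* Defs.v *)
From HB Require Import structures.
From mathcomp Require Import all_boot all_order all_algebra all_field.

Set Implicit Arguments.
Unset Strict Implicit.
Unset Printing Implicit Defensive.

Import GRing.Theory.
Local Open Scope ring_scope.

(* Tensor product of finite-dimensional spaces, realized as the matrices of
   coordinates in the bases (vbasis {:V})`_i (x) (vbasis {:W})`_j.  Its
   universal property is given by [tens_bilinear], [tens_lift_linear],
   [tens_liftE] and [eq_tens]. *)
Definition tens (k : fieldType) (V W : vectType k) :=
  'M[k]_(\dim {:V}, \dim {:W}).
HB.instance Definition _ (k : fieldType) (V W : vectType k) :=
  Vector.on (tens V W).

Definition tpure (k : fieldType) (V W : vectType k) (v : V) (w : W) :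
    tens V W :=
  \matrix_(i, j) (coord (vbasis {:V}) i v * coord (vbasis {:W}) j w).
Notation "v \ox w" := (tpure v w)
  (at level 37, left associativity, format "v  \ox  w") : ring_scope.

(* The linear map on V (x) W induced by F, which is meant to be bilinear. *)
Definition tens_lift (k : fieldType) (V W : vectType k) (U : lmodType k)
    (F : V -> W -> U) (t : tens V W) : U :=
  \sum_i \sum_j t i j *: F (vbasis {:V})`_i (vbasis {:W})`_j.

(* For t = \sum_r a_r \ox b_r and F bilinear this is \sum_r F a_r b_r. *)
Notation "\tsum_ ( a , b <- t ) F" := (tens_lift (fun a b => F) t)
  (at level 41, F at level 41, a name, b name, t at level 200,
   format "\tsum_ ( a ,  b  <-  t )  F") : ring_scope.

Definition lin (k : fieldType) (U V : lmodType k) (f : U -> V) : Prop :=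
  linear f.

Section TensTheory.
Variable k : fieldType.
Implicit Types (V W : vectType k) (U : lmodType k).

Lemma lin0 U U' (f : U -> U') : lin f -> f 0 = 0.
Proof.
by move=> lf; have:= lf (-1) 0 0; rewrite !scaleN1r !addNr.
Qed.

Lemma linZ U U' (f : U -> U') : lin f -> forall c x, f (c *: x) = c *: f x.
Proof. by move=> lf c x; rewrite -[c *: x]addr0 lf (lin0 lf) addr0. Qed.

Lemma linD U U' (f : U -> U') : lin f -> forall x y, f (x + y) = f x + f y.
Proof. by move=> lf x y; rewrite -[x]scale1r lf !scale1r. Qed.

Lemma lin_sum U U' (f : U -> U') : lin f ->
  forall I (r : seq I) F, f (\sum_(i <- r) F i) = \sum_(i <- r) f (F i).
Proof.
move=> lf I r F; elim: r => [|i r IH]; first by rewrite !big_nil lin0.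
by rewrite !big_cons (linD lf) IH.
Qed.

Lemma lin_hom V W (f : 'Hom(V, W)) : lin f.
Proof. exact: linearP. Qed.

Lemma coordE V (v : V) :
  v = \sum_i coord (vbasis {:V}) i v *: (vbasis {:V})`_i.
Proof. exact/coord_vbasis/memvf. Qed.

Lemma tens_bilinear V W : (forall w : W, lin (fun v : V => v \ox w)) /\
  (forall v : V, lin (fun w : W => v \ox w)).
Proof.
by split=> [w|v] c x y; apply/matrixP=> i j; rewrite !mxE linearP /=;
  [rewrite mulrDl mulrA | rewrite mulrDr mulrCA].
Qed.

Lemma tens_lift_linear V W U (F : V -> W -> U) : lin (tens_lift F).
Proof.
move=> c s t; rewrite /tens_lift scaler_sumr -big_split; apply: eq_bigr => i _ /=.
rewrite scaler_sumr -big_split; apply: eq_bigr => j _ /=.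
by rewrite !mxE scalerDl scalerA.
Qed.

HB.instance Definition _ V W U (F : V -> W -> U) :=
  GRing.isLinear.Build k (tens V W) U _ (tens_lift F) (tens_lift_linear F).

Lemma tens_liftE V W U (F : V -> W -> U) :
  (forall w, lin (F^~ w)) -> (forall v, lin (F v)) ->
  forall v w, tens_lift F (v \ox w) = F v w.
Proof.
move=> Fl Fr v w; rewrite {2}[v]coordE (lin_sum (Fl _)); apply: eq_bigr => i _.
rewrite (linZ (Fl _)) {2}[w]coordE (lin_sum (Fr _)) scaler_sumr.
by apply: eq_bigr => j _; rewrite (linZ (Fr _)) mxE scalerA.
Qed.

Lemma tensE V W (t : tens V W) : t = \tsum_(a, b <- t) a \ox b.
Proof.
apply/matrixP=> i j; rewrite summxE (bigD1 i) //= summxE (bigD1 j) //=.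
rewrite !mxE !coord_free ?(basis_free (vbasisP _)) // !eqxx !mulr1.
rewrite !big1 ?addr0 // => [i' ne_i|j' ne_j]; last first.
  by rewrite !mxE !coord_free ?(basis_free (vbasisP _)) //
             (negPf ne_j) !mulr0.
rewrite summxE big1 // => j' _.
by rewrite !mxE !coord_free ?(basis_free (vbasisP _)) //
           (negPf ne_i) mul0r mulr0.
Qed.

Lemma tens_lift_comp V W U U' (f : U -> U') (F : V -> W -> U) t : lin f ->
  f (tens_lift F t) = \tsum_(a, b <- t) f (F a b).
Proof.
move=> lf; rewrite /tens_lift (lin_sum lf); apply: eq_bigr => i _.
by rewrite (lin_sum lf); apply: eq_bigr => j _; rewrite (linZ lf).
Qed.

Lemma eq_tens_lift V W U (F G : V -> W -> U) t :
  (forall a b, F a b = G a b) -> tens_lift F t = tens_lift G t.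
Proof. by move=> FG; apply: eq_bigr => i _; apply: eq_bigr => j _; rewrite FG. Qed.

Lemma eq_tens V W U (f g : tens V W -> U) : lin f -> lin g ->
  (forall a b, f (a \ox b) = g (a \ox b)) -> f =1 g.
Proof.
move=> lf lg fg t; rewrite [t]tensE !tens_lift_comp //.
exact: eq_tens_lift.
Qed.

Lemma tens_lift_exch V W V' W' U (F : V -> W -> V' -> W' -> U) s t :
  \tsum_(a, b <- s) \tsum_(c, d <- t) F a b c d =
  \tsum_(c, d <- t) \tsum_(a, b <- s) F a b c d.
Proof.
rewrite /tens_lift.
under eq_bigr do under eq_bigr do rewrite scaler_sumr.
under [RHS]eq_bigr do under eq_bigr do rewrite scaler_sumr.
under eq_bigr do rewrite exchange_big.
rewrite exchange_big; apply: eq_bigr => c _.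
under eq_bigr do under eq_bigr do rewrite scaler_sumr.
under [RHS]eq_bigr do under eq_bigr do rewrite scaler_sumr.
under eq_bigr do rewrite exchange_big.
rewrite exchange_big; apply: eq_bigr => d _.
by do 2 (apply: eq_bigr => ? _); rewrite !scalerA mulrC.
Qed.

Lemma lin_id U : lin (fun x : U => x). Proof. by []. Qed.

Lemma lin_compl U U' U'' (f : {linear U' -> U''}) (g : U -> U') :
  lin g -> lin (fun x => f (g x)).
Proof. by move=> lg c x y; rewrite lg linearP. Qed.

Lemma lin_mull (A : algType k) U (f : U -> A) a : lin f -> lin (fun x => a * f x).
Proof. by move=> lf c x y; rewrite lf mulrDr scalerAr. Qed.

Lemma lin_mulr (A : algType k) U (f : U -> A) a : lin f -> lin (fun x => f x * a).
Proof. by move=> lf c x y; rewrite lf mulrDl scalerAl. Qed.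

Lemma lin_scalel U U' (f : U -> k^o) (v : U') :
  lin f -> lin (fun x => f x *: v).
Proof. by move=> lf c x y; rewrite lf scalerDl scalerA. Qed.

Lemma lin_scaler U U' (f : U -> U') (c : k) :
  lin f -> lin (fun x => c *: f x).
Proof. by move=> lf d x y; rewrite lf scalerDr !scalerA mulrC. Qed.

Lemma lin_tpurel U V W (f : U -> V) (w : W) : lin f -> lin (fun x => f x \ox w).
Proof. by move=> lf c x y; rewrite lf (proj1 (tens_bilinear V W)). Qed.

Lemma lin_tpurer U V W (v : V) (f : U -> W) : lin f -> lin (fun x => v \ox f x).
Proof. by move=> lf c x y; rewrite lf (proj2 (tens_bilinear V W)). Qed.

Lemma lin_tens_lift U U' V W (F : U -> V -> W -> U') t :
  (forall a b, lin (fun x => F x a b)) ->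
  lin (fun x => \tsum_(a, b <- t) F x a b).
Proof.
move=> lF c x y; rewrite /tens_lift scaler_sumr -big_split; apply: eq_bigr => i _ /=.
rewrite scaler_sumr -big_split; apply: eq_bigr => j _ /=.
by rewrite (lF _ _ c x y) scalerDr !scalerA mulrC.
Qed.

Lemma lin_tens_arg U U' V W (F : V -> W -> U') (f : U -> tens V W) :
  lin f -> lin (fun x => tens_lift F (f x)).
Proof. exact: lin_compl. Qed.

Lemma lin_lfun U (V W : vectType k) (f : U -> 'Hom(V, W)) (v : V) :
  lin f -> lin (fun x => f x v).
Proof. by move=> lf c x y; rewrite lf !lfunE /= lfunE. Qed.

Lemma lin_lfunr U (V W : vectType k) (f : 'Hom(V, W)) (g : U -> V) :
  lin g -> lin (fun x => f (g x)).
Proof. exact: lin_compl. Qed.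

End TensTheory.

(* [antipode] is not assumed bijective: this follows from finite dimension. *)
HB.mixin Record Falgebra_isHopf (k : fieldType) H of Falgebra k H := {
  comul : {linear H -> tens H H};
  counit : {linear H -> k^o};
  antipode : {linear H -> H};
  coassoc : forall h : H,
    \tsum_(a, c <- comul h) \tsum_(a1, a2 <- comul a) a1 \ox (a2 \ox c) =
    \tsum_(a, c <- comul h) \tsum_(c1, c2 <- comul c) a \ox (c1 \ox c2);
  counitl : forall h : H, \tsum_(a, b <- comul h) counit a *: b = h;
  counitr : forall h : H, \tsum_(a, b <- comul h) counit b *: a = h;
  comul1 : comul 1 = 1 \ox 1;
  comulM : forall x y : H, comul (x * y) =
    \tsum_(a, b <- comul x) \tsum_(c, d <- comul y) (a * c) \ox (b * d);
  counit1 : counit 1 = 1 :> k;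
  counitM : forall x y : H, counit (x * y) = counit x * counit y :> k;
  antipodel : forall h : H,
    \tsum_(a, b <- comul h) antipode a * b = (counit h : k) *: 1;
  antipoder : forall h : H,
    \tsum_(a, b <- comul h) a * antipode b = (counit h : k) *: 1
}.

#[short(type="hopfType")]
HB.structure Definition Hopf (k : fieldType) :=
  { H of Falgebra k H & Falgebra_isHopf k H }.

(* Sweedler notation: [a], [b] stand for h_(1), h_(2). *)
Notation "\sw_ ( a , b <- h ) F" := (tens_lift (fun a b => F) (comul h))
  (at level 41, F at level 41, a name, b name, h at level 200,
   format "\sw_ ( a ,  b  <-  h )  F") : ring_scope.

Definition sweedler3 (k : fieldType) (H : hopfType k) (U : lmodType k)
    (F : H -> H -> H -> U) (h : H) : U :=
  \sw_(x, c <- h) \sw_(a, b <- x) F a b c.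
Notation "\sw3_ ( a , b , c <- h ) F" := (sweedler3 (fun a b c => F) h)
  (at level 41, F at level 41, a name, b name, c name, h at level 200,
   format "\sw3_ ( a ,  b ,  c  <-  h )  F") : ring_scope.

Ltac lin_extra := fail.
(* Solves goals stating that the displayed function of one variable is linear. *)
Ltac lin_step := match goal with
  | |- lin (fun x => x) => exact: lin_id
  | |- lin (fun x => tens_lift (fun a b => @?F x a b) ?t) =>
      apply: (@lin_tens_lift _ _ _ _ _ F t) => ? ?
  | |- lin (fun x => tens_lift ?F (@?f x)) =>
      apply: (@lin_tens_arg _ _ _ _ _ F f)
  | |- lin (fun x => ?v \ox (@?f x)) => apply: (@lin_tpurer _ _ _ _ v f)
  | |- lin (fun x => (@?f x) \ox ?w) => apply: (@lin_tpurel _ _ _ _ f w)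
  | |- lin (fun x => ?a * (@?f x)) => apply: (@lin_mull _ _ _ f a)
  | |- lin (fun x => (@?f x) * ?a) => apply: (@lin_mulr _ _ _ f a)
  | |- lin (fun x => ?c *: (@?f x)) => apply: (@lin_scaler _ _ _ f c)
  | |- lin (fun x => (@?f x) *: ?v) => apply: (@lin_scalel _ _ _ f v)
  | |- lin (fun x => fun_of_lfun ?f (@?g x)) => apply: (@lin_lfunr _ _ _ _ f g)
  | |- lin (fun x => fun_of_lfun (@?f x) ?v) => apply: (@lin_lfun _ _ _ _ f v)
  | |- lin (fun x => GRing.Linear.sort ?f (@?g x)) =>
      apply: (@lin_compl _ _ _ _ f g)
  | |- _ => lin_extra
  end.
Ltac linsolve := intros; unfold sweedler3; cbn beta; repeat (lin_step; cbn beta);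
  try solve [exact: linearP | auto].

Section HopfTheory.
Variables (k : fieldType) (H : hopfType k).
Local Notation S := antipode.
Implicit Types (U : lmodType k) (h x y : H).

Lemma coassocT U (T : H -> H -> H -> U) h :
  (forall b c, lin (fun a => T a b c)) -> (forall a c, lin (fun b => T a b c)) ->
  (forall a b, lin (fun c => T a b c)) ->
  \sw_(p, c <- h) \sw_(a, b <- p) T a b c =
  \sw_(a, p <- h) \sw_(b, c <- p) T a b c.
Proof.
move=> T1 T2 T3.
have TE a b c : \tsum_(x, t <- a \ox (b \ox c)) \tsum_(y, z <- t) T x y z = T a b c.
  rewrite tens_liftE; first rewrite tens_liftE //.
  - by move=> t; apply: lin_tens_lift.
  - by move=> x; apply: lin_tens_arg; exact: lin_id.
have /(congr1 (tens_lift (fun x t => \tsum_(y, z <- t) T x y z))) := coassoc h.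
set L := tens_lift _.
have linL : lin L by exact: linearP.
rewrite !(tens_lift_comp _ _ linL) => E.
transitivity (\sw_(a, c <- h) L (\sw_(a1, a2 <- a) a1 \ox (a2 \ox c))).
  apply: eq_tens_lift => p c; rewrite (tens_lift_comp _ _ linL).
  by apply: eq_tens_lift => a b; rewrite /L TE.
rewrite E; apply: eq_tens_lift => p c; rewrite (tens_lift_comp _ _ linL).
by apply: eq_tens_lift => a b; rewrite /L TE.
Qed.

Lemma swM U (F : H -> H -> U) x y :
  (forall b, lin (F^~ b)) -> (forall a, lin (F a)) ->
  \sw_(a, b <- x * y) F a b = \sw_(a, b <- x) \sw_(c, d <- y) F (a * c) (b * d).
Proof.
move=> F1 F2; rewrite comulM (tens_lift_comp _ _ (@tens_lift_linear _ _ _ _ F)).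
apply: eq_tens_lift => a b.
rewrite (tens_lift_comp _ _ (@tens_lift_linear _ _ _ _ F)).
by apply: eq_tens_lift => c d; rewrite tens_liftE.
Qed.

Lemma sw1 U (F : H -> H -> U) :
  (forall b, lin (F^~ b)) -> (forall a, lin (F a)) ->
  \sw_(a, b <- 1) F a b = F 1 1.
Proof. by move=> F1 F2; rewrite comul1 tens_liftE. Qed.

Lemma sw_counitl U (f : H -> U) h : lin f ->
  \sw_(a, b <- h) (counit a : k) *: f b = f h.
Proof.
move=> lf; rewrite -[in RHS](counitl h) (tens_lift_comp _ _ lf).
by apply: eq_tens_lift => a b; rewrite (linZ lf).
Qed.

Lemma sw_counitr U (f : H -> U) h : lin f ->
  \sw_(a, b <- h) (counit b : k) *: f a = f h.
Proof.
move=> lf; rewrite -[in RHS](counitr h) (tens_lift_comp _ _ lf).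
by apply: eq_tens_lift => a b; rewrite (linZ lf).
Qed.

Lemma sw_antipodel U (f : H -> U) h : lin f ->
  \sw_(a, b <- h) f (S a * b) = (counit h : k) *: f 1.
Proof. by move=> lf; rewrite -(tens_lift_comp _ _ lf) antipodel (linZ lf). Qed.

Lemma sw_antipoder U (f : H -> U) h : lin f ->
  \sw_(a, b <- h) f (a * S b) = (counit h : k) *: f 1.
Proof. by move=> lf; rewrite -(tens_lift_comp _ _ lf) antipoder (linZ lf). Qed.

Lemma antipode1 : S 1 = 1 :> H.
Proof.
have := antipodel (1 : H); rewrite sw1; [|by linsolve..].
by rewrite mulr1 counit1 scale1r.
Qed.

Lemma counit_antipode h : counit (S h) = counit h.
Proof.
rewrite -[in LHS](counitr h).
have lf : lin (fun x : H => counit (S x)) by linsolve.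
rewrite (tens_lift_comp _ _ lf).
transitivity (\sw_(a, b <- h) counit (S a * b)).
  apply: eq_tens_lift => a b; rewrite (linZ lf) counitM.
  exact: mulrC.
rewrite sw_antipodel; last by linsolve.
by rewrite counit1; exact: mulr1.
Qed.

Lemma antipodeM x y : S (x * y) = S y * S x.
Proof.
transitivity (\sw_(x1, p <- x) \sw_(y1, q <- y) \sw_(x2, x3 <- p)
    \sw_(y2, y3 <- q) S (x1 * y1) * (x2 * (y2 * S y3) * S x3)).
  rewrite -(sw_counitr (f := fun z => S (z * y))); last by linsolve.
  apply: eq_tens_lift => x1 p.
  rewrite -(sw_counitr (f := fun z => _ *: S (x1 * z))); last by linsolve.
  apply: eq_tens_lift => y1 q; rewrite scalerA mulrC -scalerA.
  transitivity (\sw_(x2, x3 <- p) (counit q : k) *: (S (x1 * y1) * (x2 * S x3))).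
    rewrite (sw_antipoder (f := fun z => _ *: (S (x1 * y1) * z))); last by linsolve.
    by rewrite mulr1.
  apply: eq_tens_lift => x2 x3.
  rewrite (sw_antipoder (f := fun z => S (x1 * y1) * (x2 * z * S x3))); last by linsolve.
  by rewrite mulr1.
transitivity (\sw_(p, x3 <- x) \sw_(q, y3 <- y) \sw_(x1, x2 <- p)
    \sw_(y1, y2 <- q) S (x1 * y1) * (x2 * (y2 * S y3) * S x3)).
  under eq_tens_lift do rewrite tens_lift_exch.
  rewrite -(coassocT (T := fun x1 x2 x3 => \sw_(y1, q <- y) \sw_(y2, y3 <- q)
      S (x1 * y1) * (x2 * (y2 * S y3) * S x3))); [|by linsolve..].
  apply: eq_tens_lift => p x3; rewrite [RHS]tens_lift_exch.
  apply: eq_tens_lift => x1 x2.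
  rewrite (coassocT (T := fun y1 y2 y3 => S (x1 * y1) * (x2 * (y2 * S y3) * S x3)))
    //; by linsolve.
transitivity (\sw_(p, x3 <- x) \sw_(q, y3 <- y)
    ((counit p : k) * (counit q : k)) *: (S y3 * S x3)).
  apply: eq_tens_lift => p x3; apply: eq_tens_lift => q y3.
  transitivity (\sw_(a, b <- p * q) S a * b * (S y3 * S x3)).
    rewrite swM; [|by linsolve..].
    by do 2 apply: eq_tens_lift => ? ?; rewrite !mulrA.
  rewrite (sw_antipodel (f := fun z => z * (S y3 * S x3))); last by linsolve.
  by rewrite counitM mul1r.
transitivity (\sw_(p, x3 <- x) (counit p : k) *: (S y * S x3)).
  apply: eq_tens_lift => p x3.
  rewrite -(sw_counitl (f := fun z => (counit p : k) *: (S z * S x3))); last by linsolve.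
  by apply: eq_tens_lift => q y3; rewrite scalerA mulrC.
by rewrite (sw_counitl (f := fun z => S y * S z)); last by linsolve.
Qed.

Lemma comul_antipode h : comul (S h) = \sw_(a, b <- h) S b \ox S a.
Proof.
pose F h1 u2 v c d : tens H H :=
  \sw_(p, q <- S h1) (p * (u2 * S d)) \ox (q * (v * S c)).
transitivity (\sw_(h1, u <- h) \sw_(u1, w <- u) \sw_(u2, v <- u1)
    \sw_(c, d <- w) F h1 u2 v c d).
  rewrite -(sw_counitr (f := fun z => comul (S z))); last by linsolve.
  apply: eq_tens_lift => h1 u.
  transitivity (\sw_(q, d <- u) \sw_(u2, m <- q) \sw_(v, c <- m) F h1 u2 v c d).
    transitivity (\sw_(q, d <- u) F h1 q 1 1 d).
      rewrite /F antipode1; under [RHS]eq_tens_lift do rewrite mulr1.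
      rewrite (sw_antipoder (f := fun z => \sw_(p, q <- S h1) (p * z) \ox (q * 1))).
        by congr (_ *: _); rewrite [LHS]tensE; apply: eq_tens_lift => a b; rewrite !mulr1.
      by linsolve.
    apply: eq_tens_lift => q d.
    rewrite -(sw_counitr (f := fun z => F h1 z 1 1 d)); last by rewrite /F; linsolve.
    apply: eq_tens_lift => u2 m; rewrite /F antipode1 mulr1.
    by rewrite (sw_antipoder (f := fun z =>
      \sw_(p, q <- S h1) (p * (u2 * S d)) \ox (q * z))) //; linsolve.
  transitivity (\sw_(q, d <- u) \sw_(u1, c <- q) \sw_(u2, v <- u1) F h1 u2 v c d).
    by apply: eq_tens_lift => q d; rewrite coassocT // /F; linsolve.
  rewrite (coassocT (T := fun u1 c d => \sw_(u2, v <- u1) F h1 u2 v c d));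
    try by rewrite /F; linsolve.
  by apply: eq_tens_lift => u1 w; rewrite tens_lift_exch.
rewrite -(coassocT (T := fun h1 u1 w => \sw_(u2, v <- u1) \sw_(c, d <- w)
    F h1 u2 v c d)); try by rewrite /F; linsolve.
transitivity (\sw_(p, w <- h) (counit p : k) *: \sw_(c, d <- w) S d \ox S c).
  apply: eq_tens_lift => p w.
  under eq_tens_lift do rewrite tens_lift_exch.
  rewrite tens_lift_exch.
  rewrite (tens_lift_comp _ _ (@lin_scaler _ _ _ _ _ (@lin_id _ _))).
  apply: eq_tens_lift => c d.
  transitivity (\sw_(h1, u1 <- p) \sw_(a, b <- S h1 * u1) (a * S d) \ox (b * S c)).
    apply: eq_tens_lift => h1 u1; rewrite swM; [|by linsolve..].
    rewrite tens_lift_exch; do 2 apply: eq_tens_lift => ? ?.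
    by rewrite !mulrA.
  rewrite (sw_antipodel (f := fun z => \sw_(a, b <- z) (a * S d) \ox (b * S c))).
    by rewrite sw1; [rewrite !mul1r | by linsolve..].
  by linsolve.
by rewrite (sw_counitl (f := fun w => \sw_(c, d <- w) S d \ox S c)); last by linsolve.
Qed.

Lemma sw3E U (T : H -> H -> H -> U) h : sweedler3 T h =
  \sw_(x, c <- h) \sw_(a, b <- x) T a b c.
Proof. by []. Qed.

Lemma eq_sw3 U (F G : H -> H -> H -> U) h :
  (forall a b c, F a b c = G a b c) -> sweedler3 F h = sweedler3 G h.
Proof. by move=> FG; do 2 apply: eq_tens_lift => ? ?. Qed.

Lemma sw3_comp U U' (f : U -> U') (F : H -> H -> H -> U) h : lin f ->
  f (sweedler3 F h) = \sw3_(a, b, c <- h) f (F a b c).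
Proof.
move=> lf; rewrite /sweedler3 (tens_lift_comp _ _ lf).
by apply: eq_tens_lift => ? ?; rewrite (tens_lift_comp _ _ lf).
Qed.

Lemma sw31 U (T : H -> H -> H -> U) :
  (forall b c, lin (fun a => T a b c)) -> (forall a c, lin (fun b => T a b c)) ->
  (forall a b, lin (fun c => T a b c)) ->
  sweedler3 T 1 = T 1 1 1.
Proof.
move=> T1 T2 T3; rewrite sw3E sw1; first by rewrite sw1.
- by move=> c; apply: lin_tens_arg; exact: linearP.
- by move=> a; apply: lin_tens_lift.
Qed.

Lemma sw3M U (T : H -> H -> H -> U) x y :
  (forall b c, lin (fun a => T a b c)) -> (forall a c, lin (fun b => T a b c)) ->
  (forall a b, lin (fun c => T a b c)) ->
  sweedler3 T (x * y) = \sw3_(a, b, c <- x) \sw3_(d, e, f <- y)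
    T (a * d) (b * e) (c * f).
Proof.
move=> T1 T2 T3; rewrite sw3E swM.
- apply: eq_tens_lift => p c.
  under [RHS]eq_tens_lift do rewrite sw3E.
  rewrite [RHS]tens_lift_exch; apply: eq_tens_lift => q f.
  by rewrite swM.
- by move=> c; apply: lin_tens_arg; exact: linearP.
- by move=> a; apply: lin_tens_lift.
Qed.

Lemma sw3_exch U (T : H -> H -> H -> H -> H -> H -> U) x y :
  \sw3_(a, b, c <- x) \sw3_(d, e, f <- y) T a b c d e f =
  \sw3_(d, e, f <- y) \sw3_(a, b, c <- x) T a b c d e f.
Proof.
rewrite /sweedler3.
under eq_tens_lift do rewrite tens_lift_exch.
rewrite tens_lift_exch; apply: eq_tens_lift => p f.
under eq_tens_lift do rewrite tens_lift_exch.
by rewrite tens_lift_exch.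
Qed.

Lemma sw5 U (T : H -> H -> H -> H -> H -> U) h :
  (forall b c d e, lin (fun a => T a b c d e)) ->
  (forall a c d e, lin (fun b => T a b c d e)) ->
  (forall a b d e, lin (fun c => T a b c d e)) ->
  (forall a b c e, lin (fun d => T a b c d e)) ->
  (forall a b c d, lin (fun e => T a b c d e)) ->
  \sw3_(x, c, y <- h) \sw_(a, b <- x) \sw_(d, e <- y) T a b c d e =
  \sw3_(a, y, e <- h) \sw3_(b, c, d <- y) T a b c d e.
Proof.
move=> T1 T2 T3 T4 T5; rewrite /sweedler3.
transitivity (\sw_(p, y <- h) \sw_(d, e <- y) \sw_(x, c <- p) \sw_(a, b <- x)
    T a b c d e).
  apply: eq_tens_lift => p y; rewrite [RHS]tens_lift_exch.
  by apply: eq_tens_lift => x c; rewrite [RHS]tens_lift_exch.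
rewrite -(coassocT (T := fun p d e => \sw_(x, c <- p) \sw_(a, b <- x)
  T a b c d e)); try by linsolve.
apply: eq_tens_lift => p e.
rewrite -(coassocT (T := fun a q d => \sw_(b, c <- q) T a b c d e)); try by linsolve.
by apply: eq_tens_lift => q d; rewrite coassocT.
Qed.

End HopfTheory.

Section Dual.
Variables (k : fieldType) (H : hopfType k).
Local Notation S := antipode.

Definition hopf_dual := 'Hom(H, k^o).
HB.instance Definition _ := Vector.on hopf_dual.

(* (f * g)(h) = f(h_(2)) g(h_(1)): opposite to the usual convolution. *)
Definition dual_mul (f g : hopf_dual) : hopf_dual :=
  linfun (tens_lift (fun a b => f b * g a : k^o) \o comul).
Definition dual_one : hopf_dual := linfun (@counit k H).

Let dual_mulE' (f g : hopf_dual) (h : H) : dual_mul f g h = \sw_(a, b <- h) f b * g a.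
Proof. by rewrite lfunE. Qed.

Let dual_mulA : associative dual_mul.
Proof.
move=> f g e; apply/lfunP => h; rewrite !dual_mulE'.
transitivity (\sw_(p, c <- h) \sw_(a, b <- p) f c * (g b * e a)).
  apply: eq_tens_lift => p c; rewrite (dual_mulE' g e).
  by rewrite (tens_lift_comp (f := fun z : k^o => f c * z)) //; linsolve.
rewrite (coassocT (T := fun a b c => f c * (g b * e a))); try by linsolve.
apply: eq_tens_lift => a p; rewrite (dual_mulE' f g).
rewrite (tens_lift_comp (f := fun z : k^o => z * e a)); last by linsolve.
by apply: eq_tens_lift => ? ?; rewrite mulrA.
Qed.

Let dual_mul1r : left_id dual_one dual_mul.
Proof.
move=> f; apply/lfunP => h; rewrite dual_mulE'.
under eq_tens_lift do rewrite lfunE.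
by rewrite (sw_counitr (f := f)) //; linsolve.
Qed.

Let dual_mulr1 : right_id dual_one dual_mul.
Proof.
move=> f; apply/lfunP => h; rewrite dual_mulE'.
under eq_tens_lift do rewrite lfunE mulrC.
by rewrite (sw_counitl (f := f)) //; linsolve.
Qed.

Let dual_mulDl : left_distributive dual_mul +%R.
Proof.
move=> f g e; apply/lfunP => h; rewrite add_lfunE !dual_mulE'.
rewrite -(linD (f := fun x : hopf_dual => \sw_(a, b <- h) x b * e a)) //.
by linsolve.
Qed.

Let dual_mulDr : right_distributive dual_mul +%R.
Proof.
move=> e f g; apply/lfunP => h; rewrite add_lfunE !dual_mulE'.
rewrite -(linD (f := fun x : hopf_dual => \sw_(a, b <- h) e b * x a)) //.
by linsolve.
Qed.

Let dual_one_neq0 : dual_one != 0.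
Proof.
apply/eqP => /lfunP/(_ 1); rewrite !lfunE /= counit1 => /eqP.
by rewrite oner_eq0.
Qed.

HB.instance Definition _ := GRing.Zmodule_isNzRing.Build hopf_dual
  dual_mulA dual_mul1r dual_mulr1 dual_mulDl dual_mulDr dual_one_neq0.

Let dual_scaleAl (c : k) (f g : hopf_dual) : c *: (f * g) = (c *: f) * g.
Proof.
apply/lfunP => h; rewrite scale_lfunE !dual_mulE'.
rewrite -(linZ (f := fun x : hopf_dual => \sw_(a, b <- h) x b * g a)) //.
by linsolve.
Qed.
HB.instance Definition _ := GRing.Lmodule_isLalgebra.Build k hopf_dual dual_scaleAl.

Let dual_scaleAr (c : k) (f g : hopf_dual) : c *: (f * g) = f * (c *: g).
Proof.
apply/lfunP => h; rewrite scale_lfunE !dual_mulE'.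
rewrite -(linZ (f := fun x : hopf_dual => \sw_(a, b <- h) f b * x a)) //.
by linsolve.
Qed.
HB.instance Definition _ := GRing.Lalgebra_isAlgebra.Build k hopf_dual dual_scaleAr.
HB.instance Definition _ := Algebra_isFalgebra.Build k hopf_dual.

Lemma dual_mulE (f g : hopf_dual) (h : H) : (f * g) h = \sw_(a, b <- h) f b * g a.
Proof. exact: dual_mulE'. Qed.

Lemma dual1E (h : H) : (1 : hopf_dual) h = counit h.
Proof. by rewrite lfunE. Qed.

(* The functional f(a?b). *)
Definition sandwich (f : hopf_dual) (a b : H) : hopf_dual :=
  (f \o (amulr b \o amull a))%VF.

Lemma sandwichE f a b x : sandwich f a b x = f (a * x * b).
Proof. by rewrite !lfunE /= lfunE /= !lfunE. Qed.

Lemma lin_sandwich1 (U : lmodType k) (f : U -> hopf_dual) a b :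
  lin f -> lin (fun x => sandwich (f x) a b).
Proof.
by move=> lf c x y; apply/lfunP => h; rewrite lf sandwichE !add_lfunE !scale_lfunE !sandwichE.
Qed.

Lemma lin_sandwich2 (U : lmodType k) f (a : U -> H) b :
  lin a -> lin (fun x => sandwich f (a x) b).
Proof.
move=> la c x y; apply/lfunP => h.
by rewrite la sandwichE add_lfunE scale_lfunE !sandwichE !mulrDl -!scalerAl linearP.
Qed.

Lemma lin_sandwich3 (U : lmodType k) f a (b : U -> H) :
  lin b -> lin (fun x => sandwich f a (b x)).
Proof.
move=> la c x y; apply/lfunP => h.
by rewrite la sandwichE add_lfunE scale_lfunE !sandwichE !mulrDr -!scalerAr linearP.
Qed.

Lemma sandwich11 f : sandwich f 1 1 = f.
Proof. by apply/lfunP => x; rewrite sandwichE mul1r mulr1. Qed.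

Lemma sandwichA f a b c d :
  sandwich (sandwich f a b) c d = sandwich f (a * c) (d * b).
Proof. by apply/lfunP => x; rewrite !sandwichE !mulrA. Qed.

Lemma sandwich1 a b :
  sandwich 1 a b = ((counit a : k) * (counit b : k)) *: (1 : hopf_dual).
Proof.
apply/lfunP => x; rewrite sandwichE scale_lfunE !dual1E !counitM.
by rewrite mulrAC.
Qed.

Lemma sandwichM (f g : hopf_dual) x y :
  sandwich (f * g) (S x) y = \sw_(x1, x2 <- x) \sw_(y1, y2 <- y)
    (sandwich f (S x1) y2 * sandwich g (S x2) y1).
Proof.
apply/lfunP => z; rewrite sandwichE dual_mulE.
rewrite swM; [|by linsolve..]; rewrite swM; [|by linsolve..].
rewrite comul_antipode.
set G := (X in tens_lift X).
rewrite (tens_lift_comp (f := tens_lift G)); last by exact: linearP.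
rewrite (tens_lift_comp (f := fun t : hopf_dual => t z)); last by linsolve.
apply: eq_tens_lift => p q; rewrite tens_liftE /G; try by linsolve.
rewrite (tens_lift_comp (f := fun t : hopf_dual => t z)); last by linsolve.
rewrite tens_lift_exch; apply: eq_tens_lift => e h.
by rewrite dual_mulE; apply: eq_tens_lift => c d; rewrite !sandwichE.
Qed.

End Dual.

Ltac lin_extra ::= match goal with
  | |- lin (fun x => sandwich ?f ?a (@?b x)) => apply: (@lin_sandwich3 _ _ _ f a b)
  | |- lin (fun x => sandwich ?f (@?a x) ?b) => apply: (@lin_sandwich2 _ _ _ f a b)
  | |- lin (fun x => sandwich (@?f x) ?a ?b) => apply: (@lin_sandwich1 _ _ _ f a b)
  end.

(* The finite-dimensional left modules over A. *)
Record fdmod (k : fieldType) (A : falgType k) := FdMod {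
  fdmod_sort :> vectType k;
  fdact : {linear A -> 'End(fdmod_sort)};
  fdact1 : fdact 1 = \1%VF;
  fdactM : forall a b : A, fdact (a * b) = (fdact a \o fdact b)%VF
}.
Arguments fdact {k A} X : rename.

(* The A-module X as a module over the ring A. *)
Definition lmod_of (k : fieldType) (A : falgType k) (X : fdmod A) : Type := X.

Section LmodOf.
Variables (k : fieldType) (A : falgType k) (X : fdmod A).

HB.instance Definition _ := GRing.Zmodule.on (lmod_of X).

Let scaleA (a b : A) (v : lmod_of X) : fdact X a (fdact X b v) = fdact X (a * b) v.
Proof. by rewrite fdactM comp_lfunE. Qed.
Let scale1 (v : lmod_of X) : fdact X 1 v = v.
Proof. by rewrite fdact1 id_lfunE. Qed.
Let scaleDr (a : A) (u v : lmod_of X) : fdact X a (u + v) = fdact X a u + fdact X a v.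
Proof. exact: linearD. Qed.
Let scaleDl (v : lmod_of X) (a b : A) : fdact X (a + b) v = fdact X a v + fdact X b v.
Proof. by rewrite linearD add_lfunE. Qed.
HB.instance Definition _ := GRing.Zmodule_isLmodule.Build A (lmod_of X)
  scaleA scale1 scaleDr scaleDl.
End LmodOf.

(* The lifting property, against surjections between arbitrary modules. *)
Definition is_projective (A : nzRingType) (P : lmodType A) : Prop :=
  forall (M N : lmodType A) (p : {linear M -> N}) (f : {linear P -> N}),
    (forall y : N, exists x : M, p x = y) ->
    exists g : {linear P -> M}, forall x : P, p (g x) = f x.

Section Restrict.
Variables (k : fieldType) (A B : falgType k) (i : {lrmorphism A -> B}).
Variable X : fdmod B.

Let restrict1 : fdact X (i 1) = \1%VF.
Proof. by rewrite rmorph1 fdact1. Qed.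
Let restrictM (a b : A) :
  fdact X (i (a * b)) = (fdact X (i a) \o fdact X (i b))%VF.
Proof. by rewrite rmorphM fdactM. Qed.

Definition fdmod_restrict : fdmod A :=
  FdMod (fdact := fdact X \o i) restrict1 restrictM.
End Restrict.

Section CentralMonad.
Variables (k : fieldType) (H : hopfType k).
Local Notation S := antipode.
Implicit Type V : fdmod H.

Section Zact.
Variable V : fdmod H.

Definition Zact (h : H) (t : tens (hopf_dual H) V) : tens (hopf_dual H) V :=
  \tsum_(f, v <- t) \sw3_(h1, h2, h3 <- h)
    sandwich f (S h1) h3 \ox fdact V h2 v.

Definition Zmul (f : hopf_dual H) (t : tens (hopf_dual H) V) :
    tens (hopf_dual H) V :=
  \tsum_(g, v <- t) (f * g) \ox v.

Lemma lin_Zact1 t : lin (fun h => Zact h t). Proof. by rewrite /Zact; linsolve. Qed.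
Lemma lin_Zact2 h : lin (Zact h). Proof. by rewrite /Zact; linsolve. Qed.
Lemma lin_Zmul1 t : lin (fun f => Zmul f t). Proof. by rewrite /Zmul; linsolve. Qed.
Lemma lin_Zmul2 f : lin (Zmul f). Proof. by rewrite /Zmul; linsolve. Qed.

Lemma ZactE h f v : Zact h (f \ox v) =
  \sw3_(h1, h2, h3 <- h) sandwich f (S h1) h3 \ox fdact V h2 v.
Proof. by rewrite /Zact tens_liftE //; linsolve. Qed.

Lemma ZmulE f g v : Zmul f (g \ox v) = (f * g) \ox v.
Proof. by rewrite /Zmul tens_liftE //; linsolve. Qed.

Lemma Zact1 t : Zact 1 t = t.
Proof.
rewrite [RHS]tensE; apply: eq_tens_lift => f v; rewrite sw31; try by linsolve.
by rewrite antipode1 sandwich11 fdact1 id_lfunE.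
Qed.

Lemma ZactM g h t : Zact (g * h) t = Zact g (Zact h t).
Proof.
apply: (eq_tens (f := Zact (g * h)) (g := fun t => Zact g (Zact h t))).
- exact: lin_Zact2.
- by move=> c x y; rewrite !lin_Zact2.
move=> f v; rewrite !ZactE (sw3_comp _ _ (@lin_Zact2 g)) sw3M; try by linsolve.
rewrite sw3_exch; apply: eq_sw3 => h1 h2 h3; rewrite ZactE.
apply: eq_sw3 => g1 g2 g3.
by rewrite sandwichA antipodeM fdactM comp_lfunE.
Qed.

Lemma Zmul1 t : Zmul 1 t = t.
Proof. by rewrite [RHS]tensE; apply: eq_tens_lift => f v; rewrite mul1r. Qed.

Lemma ZmulM f g t : Zmul (f * g) t = Zmul f (Zmul g t).
Proof.
apply: (eq_tens (f := Zmul (f * g)) (g := fun t => Zmul f (Zmul g t))).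
- exact: lin_Zmul2.
- by move=> c x y; rewrite !lin_Zmul2.
by move=> e v; rewrite !ZmulE mulrA.
Qed.

Lemma Zact_mul h f t : Zact h (Zmul f t) =
  \sw3_(h1, h2, h3 <- h) Zmul (sandwich f (S h1) h3) (Zact h2 t).
Proof.
apply: (eq_tens (f := fun t => Zact h (Zmul f t))
  (g := fun t => \sw3_(h1, h2, h3 <- h) Zmul (sandwich f (S h1) h3) (Zact h2 t))).
- by move=> c x y; rewrite lin_Zmul2 lin_Zact2.
- by rewrite /Zmul /Zact; linsolve.
move=> g v; rewrite ZmulE ZactE.
transitivity (\sw3_(x, c, y <- h) \sw_(a, b <- x) \sw_(d, e <- y)
  (sandwich f (S a) e * sandwich g (S b) d) \ox fdact V c v).
  apply: eq_sw3 => x c y; rewrite sandwichM.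
  rewrite (tens_lift_comp (f := fun t : hopf_dual H => t \ox fdact V c v)); last by linsolve.
  apply: eq_tens_lift => a b.
  by rewrite (tens_lift_comp (f := fun t : hopf_dual H => t \ox fdact V c v)); last by linsolve.
rewrite (sw5 (T := fun a b c d e => (sandwich f (S a) e * sandwich g (S b) d)
  \ox fdact V c v)); try by linsolve.
apply: eq_sw3 => a y e; rewrite ZactE (sw3_comp _ _ (@lin_Zmul2 _)).
by apply: eq_sw3 => b c d; rewrite ZmulE.
Qed.
End Zact.

HB.instance Definition _ V h := GRing.isLinear.Build k (tens (hopf_dual H) V)
  (tens (hopf_dual H) V) _ (@Zact V h) (@lin_Zact2 V h).
HB.instance Definition _ V f := GRing.isLinear.Build k (tens (hopf_dual H) V)
  (tens (hopf_dual H) V) _ (@Zmul V f) (@lin_Zmul2 V f).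

Definition Zact_lfun V (h : H) : 'End(tens (hopf_dual H) V) := linfun (@Zact V h).

Let Zact_lfun_linear V : linear (Zact_lfun V).
Proof.
move=> c x y; apply/lfunP => t.
by rewrite add_lfunE scale_lfunE !lfunE /= lin_Zact1.
Qed.
HB.instance Definition _ V := GRing.isLinear.Build k H 'End(tens (hopf_dual H) V) _
  (Zact_lfun V) (@Zact_lfun_linear V).

Let Zact_lfun1 V : Zact_lfun V 1 = \1%VF.
Proof. by apply/lfunP => t; rewrite id_lfunE lfunE /= Zact1. Qed.
Let Zact_lfunM V (a b : H) :
  Zact_lfun V (a * b) = (Zact_lfun V a \o Zact_lfun V b)%VF.
Proof. by apply/lfunP => t; rewrite comp_lfunE !lfunE /= ZactM. Qed.

Definition Zmonad V : fdmod H := FdMod (@Zact_lfun1 V) (@Zact_lfunM V).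

Lemma fdact_ZmonadE V h (t : Zmonad V) : fdact (Zmonad V) h t = Zact h t.
Proof. by rewrite lfunE. Qed.

Lemma fdact_Zmonad V h (f : hopf_dual H) (v : V) : fdact (Zmonad V) h (f \ox v) =
  \sw3_(h1, h2, h3 <- h) sandwich f (S h1) h3 \ox fdact V h2 v.
Proof. by rewrite fdact_ZmonadE ZactE. Qed.

(* id (x) beta *)
Definition Zmonad_map (V W : fdmod H) (beta : 'Hom(V, W)) :
    'Hom(Zmonad V, Zmonad W) :=
  linfun (tens_lift (fun f v => f \ox beta v)).

HB.instance Definition _ V := GRing.isLinear.Build k V (tens (hopf_dual H) V) _
  (tpure (1 : hopf_dual H)) (proj2 (tens_bilinear (hopf_dual H) V) 1).
Definition Zmonad_unit V : 'Hom(V, Zmonad V) := linfun (tpure (1 : hopf_dual H)).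

(* f (x) g (x) v |-> (f * g) (x) v *)
Definition Zmonad_mul V : 'Hom(Zmonad (Zmonad V), Zmonad V) :=
  linfun (tens_lift (fun (f : hopf_dual H) (t : Zmonad V) =>
    \tsum_(g, v <- t) (f * g) \ox v)).

Lemma Zmonad_mulE V f t : Zmonad_mul V (f \ox t) = Zmul f t.
Proof.
rewrite lfunE /= tens_liftE //.
- by move=> w; apply: lin_tens_lift => a b; linsolve.
- by move=> v; exact: tens_lift_linear.
Qed.

Lemma Zmonad_mapE (V W : fdmod H) (beta : 'Hom(V, W)) f v :
  Zmonad_map beta (f \ox v) = f \ox beta v.
Proof. by rewrite lfunE /= tens_liftE //; linsolve. Qed.

Lemma Zmonad_unitE V (v : V) : Zmonad_unit V v = 1 \ox v.
Proof. by rewrite lfunE. Qed.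

End CentralMonad.

Section Comonad.
Variables (k : fieldType) (H : hopfType k).

(* ZMod beta is the Z-module (V, beta); V = zobj, beta = zstr. *)
Record zmod := ZMod {
  zobj :> fdmod H;
  zstr : 'Hom(Zmonad zobj, zobj);
  zstr_act : forall (h : H) (t : Zmonad zobj),
    zstr (fdact (Zmonad zobj) h t) = fdact zobj h (zstr t);
  zstr_eta : forall v : zobj, zstr (Zmonad_unit zobj v) = v;
  zstr_mu : forall t : Zmonad (Zmonad zobj),
    zstr (Zmonad_map zstr t) = zstr (Zmonad_mul zobj t)
}.

Definition zmod_hom (X Y : zmod) (s : 'Hom(X, Y)) : Prop :=
  (forall (h : H) (v : X), s (fdact X h v) = fdact Y h (s v)) /\
  (forall t : Zmonad X, s (zstr X t) = zstr Y (Zmonad_map s t)).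

Let mu_act (X : zmod) (h : H) (t : Zmonad (Zmonad X)) :
  Zmonad_mul X (fdact (Zmonad (Zmonad X)) h t) =
  fdact (Zmonad X) h (Zmonad_mul X t).
Proof.
apply: (eq_tens (f := fun t => Zmonad_mul X (fdact (Zmonad (Zmonad X)) h t))
  (g := fun t => fdact (Zmonad X) h (Zmonad_mul X t))); try by linsolve.
move=> f u; rewrite fdact_Zmonad (Zmonad_mulE f u) fdact_ZmonadE Zact_mul
  (sw3_comp _ _ (lin_hom (Zmonad_mul X))).
by apply: eq_sw3 => a b c; rewrite Zmonad_mulE fdact_ZmonadE.
Qed.

Let mu_eta (X : zmod) (t : Zmonad X) : Zmonad_mul X (Zmonad_unit (Zmonad X) t) = t.
Proof. by rewrite Zmonad_unitE Zmonad_mulE Zmul1. Qed.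

Let mu_mu (X : zmod) (t : Zmonad (Zmonad (Zmonad X))) :
  Zmonad_mul X (Zmonad_map (Zmonad_mul X) t) = Zmonad_mul X (Zmonad_mul (Zmonad X) t).
Proof.
apply: (eq_tens (f := fun t => Zmonad_mul X (Zmonad_map (Zmonad_mul X) t))
  (g := fun t => Zmonad_mul X (Zmonad_mul (Zmonad X) t))); try by linsolve.
move=> f u; rewrite Zmonad_mapE !Zmonad_mulE.
apply: (eq_tens (f := fun u => Zmul f (Zmonad_mul X u))
  (g := fun u => Zmonad_mul X (Zmul f u))).
- by move=> c x y; rewrite linearP /= lin_Zmul2.
- by move=> c x y; rewrite lin_Zmul2 linearP.
by move=> g v; rewrite ZmulE !Zmonad_mulE ZmulM.
Qed.

Definition Gcomonad (X : zmod) : zmod := ZMod (@mu_act X) (@mu_eta X) (@mu_mu X).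

Definition Gcounit (X : zmod) : 'Hom(Gcomonad X, X) := zstr X.

Lemma Gcounit_hom (X : zmod) : zmod_hom (X := Gcomonad X) (Gcounit X).
Proof. by split=> [h v|t]; [exact: zstr_act | rewrite /= zstr_mu]. Qed.

Definition Gprojective (X : zmod) : Prop :=
  exists2 s : 'Hom(X, Gcomonad X), zmod_hom s & forall v : X, Gcounit X (s v) = v.

End Comonad.

Section Double.
Variables (k : fieldType) (H : hopfType k).
Local Notation S := antipode.

Definition drinfeld_double := tens (hopf_dual H) H.
HB.instance Definition _ := Vector.on drinfeld_double.

(* (psi (x) h) (phi (x) g) = psi * phi(S(h_(1))?h_(3)) (x) h_(2) g *)
Definition double_mul (x y : drinfeld_double) : drinfeld_double :=
  \tsum_(psi, h <- x) \tsum_(phi, g <- y) \sw3_(h1, h2, h3 <- h)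
    (psi * sandwich phi (S h1) h3) \ox (h2 * g).
Definition double_one : drinfeld_double := 1 \ox 1.

(* The product of D(H) is its action [dact] on Z(H), for H regular. *)
Let regM (a b : H) : amull (a * b) = (amull a \o amull b)%VF.
Proof. by apply/lfunP => x; rewrite comp_lfunE !lfunE /= mulrA. Qed.
Let reg : fdmod H := FdMod (fdact := @amull k H) (amull1 H) regM.

Definition dact (V : fdmod H) (x : drinfeld_double) (t : Zmonad V) : Zmonad V :=
  \tsum_(f, h <- x) Zmul f (Zact h t).

Lemma dactE (V : fdmod H) f h (t : Zmonad V) : dact (f \ox h) t = Zmul f (Zact h t).
Proof.
rewrite /dact tens_liftE // => [h'|f'].
  exact: lin_Zmul1.
by move=> c x y; rewrite lin_Zact1 lin_Zmul2.
Qed.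

Lemma lin_dact1 (V : fdmod H) (t : Zmonad V) : lin (fun x => dact x t).
Proof. exact: tens_lift_linear. Qed.

Lemma lin_dact2 (V : fdmod H) x : lin (@dact V x).
Proof.
by apply: lin_tens_lift => f h c t u; rewrite lin_Zact2 lin_Zmul2.
Qed.

Let double_mulE x y : double_mul x y = dact x (y : Zmonad reg).
Proof.
apply: eq_tens_lift => psi h.
rewrite [in RHS](tensE y) (tens_lift_comp _ _ (@lin_Zact2 _ _ reg h)).
rewrite (tens_lift_comp _ _ (@lin_Zmul2 _ _ reg psi)).
apply: eq_tens_lift => phi g; rewrite ZactE (sw3_comp _ _ (@lin_Zmul2 _ _ reg psi)).
by apply: eq_sw3 => a b c; rewrite ZmulE lfunE.
Qed.

Lemma dactM (V : fdmod H) x y (t : Zmonad V) :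
  dact (double_mul x y) t = dact x (dact y t).
Proof.
rewrite double_mulE.
apply: (eq_tens (f := fun x : drinfeld_double => dact (dact x (y : Zmonad reg) : drinfeld_double) t)
   (g := fun x : drinfeld_double => dact x (dact y t))).
- by move=> c u v; rewrite lin_dact1 lin_dact1.
- exact: lin_dact1.
move=> psi h; rewrite !dactE.
apply: (eq_tens (f := fun y : Zmonad reg => dact (Zmul psi (Zact h y) : drinfeld_double) t)
   (g := fun y => Zmul psi (Zact h (dact y t)))).
- by move=> c u v; rewrite lin_Zact2 lin_Zmul2 lin_dact1.
- by move=> c u v; rewrite lin_dact1 lin_Zact2 lin_Zmul2.
move=> phi g; rewrite dactE Zact_mul ZactE (sw3_comp _ _ (@lin_Zmul2 _ _ reg psi)).
rewrite (sw3_comp _ _ (lin_dact1 t)) (sw3_comp _ _ (@lin_Zmul2 _ _ V psi)).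
apply: eq_sw3 => a b c.
by rewrite ZmulE dactE lfunE /= ZactM ZmulM.
Qed.

Let dact1 (V : fdmod H) (t : Zmonad V) : dact double_one t = t.
Proof. by rewrite dactE Zact1 Zmul1. Qed.

Lemma Zact_one (V : fdmod H) h (v : V) : Zact h (1 \ox v) = 1 \ox fdact V h v.
Proof.
rewrite ZactE sw3E.
transitivity (\sw_(x, c <- h) (counit c : k) *: \sw_(a, b <- x)
    ((counit a : k) *: ((1 : hopf_dual H) \ox fdact V b v))).
  apply: eq_tens_lift => x c.
  rewrite (tens_lift_comp _ _ (@lin_scaler _ _ _ _ _ (@lin_id _ _))).
  apply: eq_tens_lift => a b.
  rewrite sandwich1 counit_antipode scalerA mulrC.
  by rewrite -(linZ (f := fun z : hopf_dual H => z \ox fdact V b v)) //; linsolve.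
rewrite (sw_counitr (f := fun x => \sw_(a, b <- x)
    ((counit a : k) *: ((1 : hopf_dual H) \ox fdact V b v)))); last by linsolve.
by rewrite (sw_counitl (f := fun b => (1 : hopf_dual H) \ox fdact V b v)); last by linsolve.
Qed.

Let double_mulA : associative double_mul.
Proof. by move=> x y z; rewrite [RHS]double_mulE dactM -!double_mulE. Qed.

Let double_mul1 : left_id double_one double_mul.
Proof. by move=> x; rewrite double_mulE dact1. Qed.

Let double_mulr1 : right_id double_one double_mul.
Proof.
move=> x; rewrite double_mulE.
rewrite [RHS]tensE; apply: eq_tens_lift => psi h.
by rewrite Zact_one ZmulE mulr1 lfunE /= mulr1.
Qed.

Let double_mulDl : left_distributive double_mul +%R.
Proof. by move=> x y z; rewrite !double_mulE (linD (lin_dact1 _)). Qed.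

Let double_mulDr : right_distributive double_mul +%R.
Proof. by move=> x y z; rewrite !double_mulE (linD (@lin_dact2 reg _)). Qed.

Let double_one_neq0 : double_one != 0.
Proof.
pose F (f : hopf_dual H) (h : H) : k^o := f 1 * counit h.
have lF : tens_lift F double_one = 1.
  rewrite tens_liftE /F; try by linsolve.
  by rewrite dual1E !counit1 mulr1.
apply/eqP => E; move/eqP: lF; rewrite E linear0 eq_sym.
by rewrite oner_eq0.
Qed.

HB.instance Definition _ := GRing.Zmodule_isNzRing.Build drinfeld_double
  double_mulA double_mul1 double_mulr1 double_mulDl double_mulDr double_one_neq0.

Let double_scaleAl (c : k) (x y : drinfeld_double) : c *: (x * y) = (c *: x) * y.
Proof. by rewrite ![_ * y]double_mulE (linZ (lin_dact1 _)). Qed.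
HB.instance Definition _ := GRing.Lmodule_isLalgebra.Build k drinfeld_double double_scaleAl.

Let double_scaleAr (c : k) (x y : drinfeld_double) : c *: (x * y) = x * (c *: y).
Proof. by rewrite ![x * _]double_mulE (linZ (@lin_dact2 reg _)). Qed.
HB.instance Definition _ := GRing.Lalgebra_isAlgebra.Build k drinfeld_double double_scaleAr.
HB.instance Definition _ := Algebra_isFalgebra.Build k drinfeld_double.

Lemma double_pureM psi h phi g :
  (psi \ox h : drinfeld_double) * (phi \ox g) = \sw3_(h1, h2, h3 <- h)
    (psi * sandwich phi (S h1) h3) \ox (h2 * g).
Proof.
rewrite [LHS]double_mulE dactE ZactE (sw3_comp _ _ (@lin_Zmul2 _ _ reg psi)).
by apply: eq_sw3 => a b c; rewrite ZmulE lfunE.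
Qed.

Definition dual_embed (psi : hopf_dual H) : drinfeld_double := psi \ox 1.
Definition hopf_embed (h : H) : drinfeld_double := 1 \ox h.

Lemma double_pure psi h : psi \ox h = dual_embed psi * hopf_embed h.
Proof.
rewrite double_pureM sw31; try by linsolve.
by rewrite antipode1 sandwich11 mulr1 mul1r.
Qed.

Let dual_embed_linear : linear dual_embed.
Proof. exact: (proj1 (tens_bilinear _ _)). Qed.
HB.instance Definition _ := GRing.isLinear.Build k (hopf_dual H) drinfeld_double _
  dual_embed dual_embed_linear.
Let dual_embed_monoid : monoid_morphism dual_embed.
Proof.
split=> // x y; rewrite double_pureM sw31; try by linsolve.
by rewrite antipode1 sandwich11 mulr1.
Qed.
HB.instance Definition _ := GRing.isMonoidMorphism.Build (hopf_dual H) drinfeld_double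
  dual_embed dual_embed_monoid.

Let hopf_embed_linear : linear hopf_embed.
Proof. exact: (proj2 (tens_bilinear _ _)). Qed.
HB.instance Definition _ := GRing.isLinear.Build k H drinfeld_double _
  hopf_embed hopf_embed_linear.
Let hopf_embed_monoid : monoid_morphism hopf_embed.
Proof.
split=> // x y; rewrite [RHS]double_mulE dactE Zmul1 (Zact_one (V := reg)).
by rewrite lfunE.
Qed.
HB.instance Definition _ := GRing.isMonoidMorphism.Build H drinfeld_double
  hopf_embed hopf_embed_monoid.

(* The identification of D(H)-modules with Z-modules, see [zmod_of_doubleE]. *)
Section ZmodOfDouble.
Variable X : fdmod drinfeld_double.
Let V : fdmod H := fdmod_restrict hopf_embed X.

Definition double_str : 'Hom(Zmonad V, V) :=
  linfun (tens_lift (fun psi (v : V) => fdact X (dual_embed psi) v : V)).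

Lemma double_strE psi (v : V) : double_str (psi \ox v) = fdact X (dual_embed psi) v.
Proof. by rewrite lfunE /= tens_liftE //; linsolve. Qed.

Let double_str_act (h : H) (t : Zmonad V) :
  double_str (fdact (Zmonad V) h t) = fdact V h (double_str t).
Proof.
apply: (eq_tens (f := fun t => double_str (fdact (Zmonad V) h t))
  (g := fun t => fdact V h (double_str t))); try by linsolve.
move=> psi v; rewrite fdact_Zmonad double_strE (sw3_comp _ _ (lin_hom double_str)).
rewrite -comp_lfunE -fdactM /hopf_embed double_pureM.
rewrite (sw3_comp (f := fun x => fdact X x v)); last by linsolve.
apply: eq_sw3 => a b c; rewrite double_strE /= -comp_lfunE -fdactM.
by rewrite -double_pure mul1r mulr1.
Qed.

Let double_str_eta (v : V) : double_str (Zmonad_unit V v) = v.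
Proof. by rewrite Zmonad_unitE double_strE rmorph1 fdact1 id_lfunE. Qed.

Let double_str_mu (t : Zmonad (Zmonad V)) :
  double_str (Zmonad_map double_str t) = double_str (Zmonad_mul V t).
Proof.
apply: (eq_tens (f := fun t => double_str (Zmonad_map double_str t))
  (g := fun t => double_str (Zmonad_mul V t))); try by linsolve.
move=> f u; rewrite Zmonad_mapE Zmonad_mulE double_strE.
apply: (eq_tens (f := fun u => fdact X (dual_embed f) (double_str u))
  (g := fun u => double_str (Zmul f u))); try by linsolve.
by move=> g v; rewrite ZmulE !double_strE rmorphM fdactM comp_lfunE.
Qed.

Definition zmod_of_double : zmod H :=
  ZMod double_str_act double_str_eta double_str_mu.

Lemma zmod_of_doubleE psi h (v : X) :
  fdact X (psi \ox h) v = zstr zmod_of_double (psi \ox fdact zmod_of_double h v).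
Proof. by rewrite double_strE double_pure fdactM comp_lfunE. Qed.

End ZmodOfDouble.

End Double.

(* Main.v *)
Require Import Defs.
From HB Require Import structures.
From mathcomp Require Import all_boot all_order all_algebra all_field.

(** A splitting [s] of the counit of [G] at [X] exhibits [X], restricted to
    [H^*], as a direct summand of [Z(X) = H^* (x) X], on which [H^*] acts by
    left multiplication on the first factor: the latter is a free [H^*]-module,
    with basis the elements [1 (x) e_i] for [(e_i)] a basis of [X] over [k].

    The summand is not handled as such.  Composing [s] with the coordinate
    forms [dual_coef i : H^* (x) X -> H^*] of this free module gives
    [H^*]-linear forms on [X] which, together with the [e_i], form a dual basis:
    [x = \sum_i dual_coef i (s x) e_i], because the right hand side is the
    counit applied to [s x] ([zstr_dual_coef]).  The dual basis criterion
    [dual_basis_projective] concludes. *)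

Set Implicit Arguments.
Unset Strict Implicit.
Unset Printing Implicit Defensive.

Import GRing.Theory.
Local Open Scope ring_scope.

(** To lift [f] along [p], it suffices to lift the finitely many values
    [f (e i)], and to combine the lifts with the coefficients [phi i]. *)
Lemma dual_basis_projective (A : nzRingType) (P : lmodType A) (n : nat)
    (e : 'I_n -> P) (phi : 'I_n -> P -> A^o) :
  (forall i, linear (phi i)) ->
  (forall x, x = \sum_i (phi i x : A) *: e i) ->
  is_projective P.
Proof.
move=> lin_phi expand M N p f p_surj.
have [m pm] := fin_all_exists (fun i => p_surj (f (e i))).
pose g x := \sum_i (phi i x : A) *: m i.
have lin_g : linear g.
  move=> a x y; rewrite /g scaler_sumr -big_split; apply: eq_bigr => i _ /=.
  by rewrite lin_phi scalerDl scalerA.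
pose gL : GRing.isLinear A P M _ g := GRing.isLinear.Build A P M _ g lin_g.
exists (HB.pack_for {linear P -> M} g gL) => x /=.
rewrite [in RHS](expand x) !linear_sum; apply: eq_bigr => i _.
by rewrite !linearZ /= pm.
Qed.

Section FreeModule.
Variables (k : fieldType) (H : hopfType k) (V : fdmod H).

Definition dual_coef (i : 'I_(\dim {:V})) (t : Zmonad V) : hopf_dual H :=
  \tsum_(f, v <- t) (coord (vbasis {:V}) i v : k) *: f.

Lemma dual_coef_lin i : lin (dual_coef i).
Proof. exact: tens_lift_linear. Qed.

Lemma dual_coefE i f v : dual_coef i (f \ox v) = coord (vbasis {:V}) i v *: f.
Proof.
rewrite /dual_coef tens_liftE // => [w|g] c x y.
  by rewrite scalerDr !scalerA mulrC.
by rewrite linearP /= scalerDl scalerA.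
Qed.

Lemma dual_coef_mul i f t : dual_coef i (Zmul f t) = f * dual_coef i t.
Proof.
apply: (eq_tens (f := fun t => dual_coef i (Zmul f t))
  (g := fun t => f * dual_coef i t)).
- by move=> c x y; rewrite lin_Zmul2 dual_coef_lin.
- by apply: lin_mull; exact: dual_coef_lin.
by move=> g v; rewrite ZmulE !dual_coefE scalerAr.
Qed.

End FreeModule.

Section DoubleModule.
Variables (k : fieldType) (H : hopfType k) (X : fdmod (drinfeld_double H)).
Let Z := zmod_of_double X.

(** The counit is the [H^*]-linear map from the free module [H^* (x) X] sending
    each [1 (x) e_i] to [e_i]. *)
Lemma zstr_dual_coef (t : Zmonad Z) :
  zstr Z t = \sum_i fdact X (dual_embed (dual_coef i t)) (vbasis {:Z})`_i.
Proof.
apply: (eq_tens (f := fun t => zstr Z t) (g := fun t : Zmonad Z =>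
  \sum_i fdact X (dual_embed (dual_coef i t)) (vbasis {:Z})`_i)).
- exact: lin_hom.
- move=> c x y; rewrite scaler_sumr -big_split; apply: eq_bigr => i _ /=.
  by rewrite dual_coef_lin !linearP add_lfunE scale_lfunE.
move=> f v; rewrite double_strE [in LHS](coordE v) linear_sum.
apply: eq_bigr => i _.
by rewrite dual_coefE !linearZ /= scale_lfunE.
Qed.

(** Since [G X] carries the multiplication of the monad as structure map, a
    morphism to it is [H^*]-linear for left multiplication on [H^* (x) X]. *)
Lemma zmod_hom_dual_embed (s : 'Hom(Z, Gcomonad Z)) f (x : X) :
  zmod_hom s -> s (fdact X (dual_embed f) x) = Zmul f (s x).
Proof.
move=> [_ s_zstr]; rewrite -(@double_strE _ _ X f x) s_zstr Zmonad_mapE.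
exact: Zmonad_mulE.
Qed.

End DoubleModule.

Theorem corollary9 (k : fieldType) (H : hopfType k)
    (X : fdmod (drinfeld_double H)) :
  Gprojective (zmod_of_double X) ->
  is_projective (lmod_of (fdmod_restrict (@dual_embed k H) X)).
Proof.
case=> s s_hom s_split.
apply: (@dual_basis_projective (hopf_dual H)
  (lmod_of (fdmod_restrict (@dual_embed k H) X)) (\dim {:zmod_of_double X})
  (fun i => (vbasis {:zmod_of_double X})`_i)
  (fun i x => dual_coef i (s x))) => [i f x y|x].
- have -> : s (f *: x + y) = Zmul f (s x) + s y.
    by rewrite linearD -zmod_hom_dual_embed.
  by rewrite (linD (@dual_coef_lin _ _ _ i)) dual_coef_mul.
- by rewrite -[LHS]s_split; exact: zstr_dual_coef.
Qed.
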